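(* Suppose that the set $A_0$ contains only $1\le k<\infty$ linearly independent elements $\xi_1,\dots,\xi_k$. Let $N<\infty$ and let $f_N\ge0$ be an $\mathcal F_N$-measurable contingent claim integrable relative to every measure $P\in M$. If there exist $\xi_0\in T$ and $\alpha_0\ge0$ such that $$P\big(f_N-\alpha_0E^P\{\xi_0|\mathcal F_N\}\le0\big)=1,\qquad P\in M,$$ where $$T=\Big\{\xi\ge0:\ \xi=\sum_{i=1}^k\alpha_i\xi_i,\ \alpha_i\ge0,\ i=1,\dots,k,\ \sum_{i=1}^k\alpha_i=1\Big\},$$ then the fair price $f_0$ of the contingent claim $f_N$ relative to $M$ exists.
   Context: Let $(\Omega,\mathcal F)$ be a measurable space with a filtration $\mathcal F_0\subset\mathcal F_1\subset\dots\subset\mathcal F$, where $\mathcal F_0=\{\emptyset,\Omega\}$, $\mathcal F=\sigma(\bigcup_{n\ge1}\mathcal F_n)$, and $M$ a convex set of pairwise equivalent probability measures on $\mathcal F$. Standing assumption: for all $P,Q\in M$ the density $\frac{dP}{dQ}$ is $\mathcal F_1$-measurable and $P_0\left(\frac{dP}{dQ}>0\right)=1$, where $P_0\in M$ is fixed. $A_0$ is the set of all nonnegative $M$-integrable random variables $\xi$ with $E^P\xi=1$ for all $P\in M$; for $\xi\in A_0$, $E^P\{\xi|\mathcal F_m\}$ does not depend on $P\in M$. Fair price: let $f_N$ be an $\mathcal F_N$-measurable random variable, integrable relative to $M$, such that for some $0\le\alpha_0<\infty$ and $\xi_0\in A_0$, $P(f_N-\alpha_0E^P\{\xi_0|\mathcal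 F_N\}\le0)=1$. Put $$G_{\alpha_0}=\{\alpha\in[0,\alpha_0]:\ \exists\,\xi_\alpha\in A_0,\ P(f_N-\alpha E^P\{\xi_\alpha|\mathcal F_N\}\le0)=1\}.$$ The number $f_0=\inf_{\alpha\in G_{\alpha_0}}\alpha$ is called the fair price of the contingent claim $f_N$ relative to $M$ (and the fair price is said to exist) if there exist $\zeta_0\in A_0$ and sequences $\alpha_n\in[0,\alpha_0]$, $\xi_{\alpha_n}\in A_0$ such that $\alpha_n\to f_0$, $\xi_{\alpha_n}\to\zeta_0$ in probability as $n\to\infty$, and $P(f_N-\alpha_nE^P\{\xi_{\alpha_n}|\mathcal F_N\}\le0)=1$ for all $n\ge1$. *)

(* Defs.v *)
From HB Require Import structures.
From mathcomp Require Import all_boot all_order all_algebra.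
From mathcomp Require Import all_classical all_reals all_analysis.

Set Implicit Arguments.
Unset Strict Implicit.
Unset Printing Implicit Defensive.

Import Order.TTheory GRing.Theory Num.Theory.
Import numFieldNormedType.Exports.

Local Open Scope classical_set_scope.
Local Open Scope ring_scope.
Local Open Scope charge_scope.

Section FairPrice.
Context (d : measure_display) (T : measurableType d) (R : realType).

(* For a sigma-algebra [G] the measurable sets of [g_sigma_algebraType G] are
   exactly the members of [G]. *)
Definition sub_measurable_fun (G : set (set T)) (f : T -> R) : Prop :=
  measurable_fun [set: g_sigma_algebraType G] f.

Record filtration (F : nat -> set (set T)) : Prop := Filtration {
  filtration_sigma_algebra : forall n, sigma_algebra [set: T] (F n) ;
  filtration_le : forall m n, (m <= n)%N -> F m `<=` F n ;
  filtration_measurable : forall n, F n `<=` measurable ;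
  filtration0 : F 0%N = [set set0; [set: T]] ;
  filtration_gen :
    (measurable : set (set T)) = <<s \bigcup_(n in [set n | (1 <= n)%N]) F n >>
}.

(* Convex combinations are compared on measurable sets only: a
   [probability T R] is a function on all subsets of [T]. *)
Definition convex_family (M : set (probability T R)) : Prop :=
  forall (P Q : probability T R) (t : R), M P -> M Q -> 0 <= t <= 1 ->
  exists2 S : probability T R, M S &
    forall A, measurable A -> S A = (t%:E * P A + (1 - t)%:E * Q A)%E.

Definition density (P Q : probability T R) : T -> \bar R :=
  'd (charge_of_finite_measure P) '/d Q.

(* A density is determined up to a null set only, so its F_1-measurability
   means that it has an F_1-measurable (real-valued) version. *)
Record admissible_family (F : nat -> set (set T)) (M : set (probability T R))
    (P0 : probability T R) : Prop := AdmissibleFamily {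
  family_base : M P0 ;
  family_convex : convex_family M ;
  family_equiv : forall P Q, M P -> M Q -> P `<< Q ;
  family_density_measurable : forall P Q, M P -> M Q ->
    exists2 rho : T -> R, sub_measurable_fun (F 1%N) rho &
      {ae Q, forall x, density P Q x = (rho x)%:E} ;
  family_density_gt0 : forall P Q, M P -> M Q ->
    P0 [set x | (0 < density P Q x)%E] = 1%E
}.

Definition M_integrable (M : set (probability T R)) (f : T -> R) : Prop :=
  forall P, M P -> P.-integrable [set: T] (EFin \o f).

Definition A0 (M : set (probability T R)) : set (T -> R) :=
  [set xi | [/\ forall x, 0 <= xi x, M_integrable M xi &
                forall P, M P -> ('E_P[xi] = 1)%E]].

Definition is_cond_exp (P : probability T R) (G : set (set T))
    (xi g : T -> R) : Prop :=
  [/\ sub_measurable_fun G g,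
      P.-integrable [set: T] (EFin \o g) &
      forall A, G A -> (\int[P]_(x in A) (g x)%:E = \int[P]_(x in A) (xi x)%:E)%E].

(* E^P{xi | G}: a chosen version.  For P-integrable [xi] and a sub-sigma-algebra
   [G] a version exists and is P-a.s. unique; the default [cst 0] plays a role
   only for other arguments. *)
Definition cond_exp (P : probability T R) (G : set (set T)) (xi : T -> R) :
    T -> R :=
  xget (cst 0) [set g | is_cond_exp P G xi g].

Definition superhedged (F : nat -> set (set T)) (M : set (probability T R))
    (N : nat) (f : T -> R) (a : R) (xi : T -> R) : Prop :=
  forall P, M P -> P [set x | f x - a * cond_exp P (F N) xi x <= 0] = 1%E.

Definition price_set (F : nat -> set (set T)) (M : set (probability T R))
    (N : nat) (f : T -> R) (a0 : R) : set R :=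
  [set a | 0 <= a <= a0 /\ exists2 xi, A0 M xi & superhedged F M N f a xi].

Definition fair_price (F : nat -> set (set T)) (M : set (probability T R))
    (N : nat) (f : T -> R) (a0 : R) : R :=
  inf (price_set F M N f a0).

Definition cvg_in_probability (P : probability T R) (xi : nat -> T -> R)
    (zeta : T -> R) : Prop :=
  forall e : R, 0 < e ->
    P [set x | e < `|xi n x - zeta x|] @[n --> \oo] --> 0%E.

Definition fair_price_exists (F : nat -> set (set T))
    (M : set (probability T R)) (N : nat) (f : T -> R) (a0 : R) : Prop :=
  exists (zeta : T -> R) (a : nat -> R) (xi : nat -> T -> R),
  [/\ A0 M zeta,
      forall n, 0 <= a n <= a0 /\ A0 M (xi n),
      a n @[n --> \oo] --> fair_price F M N f a0,
      forall P, M P -> cvg_in_probability P xi zeta &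
      forall n, superhedged F M N f (a n) (xi n)].

(* Random variables are identified when they are a.s. equal, so linear
   independence is relative to the null sets of [P]. *)
Definition lin_indep (P : probability T R) (k : nat) (xi : 'I_k -> T -> R) :
    Prop :=
  forall c : 'I_k -> R,
    {ae P, forall x, \sum_(i < k) c i * xi i x = 0} -> forall i, c i = 0.

Definition max_lin_indep (P : probability T R) (A : set (T -> R)) (k : nat)
    (xi : 'I_k -> T -> R) : Prop :=
  [/\ forall i, A (xi i), lin_indep P xi &
      forall (m : nat) (eta : 'I_m -> T -> R),
        (forall j, A (eta j)) -> lin_indep P eta -> (m <= k)%N].

Definition convex_combinations (k : nat) (xi : 'I_k -> T -> R) : set (T -> R) :=
  [set z | (forall x, 0 <= z x) /\
    exists a : 'I_k -> R,
      [/\ forall i, 0 <= a i, \sum_(i < k) a i = 1 &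
          forall x, z x = \sum_(i < k) a i * xi i x]].

End FairPrice.

(* Main.v *)
Require Import Defs.
From HB Require Import structures.
From mathcomp Require Import all_boot all_order all_algebra.
From mathcomp Require Import all_classical all_reals all_analysis.
From mathcomp Require Import measurable_realfun.

Import Order.TTheory GRing.Theory Num.Theory.
Import numFieldNormedType.Exports.

Local Open Scope classical_set_scope.
Local Open Scope ring_scope.

(* By maximality of the family [xi], every element of [A0 M] is almost surely a
   linear combination of the [xi i], with coefficients of sum 1 but not
   necessarily nonnegative.  Its L^1 norm under [P0] is 1, and by linear
   independence this norm dominates a multiple of the norm on R^k, so the
   coefficient vectors are bounded.  Given superhedging pairs [(a n, eta n)] with
   [a n] tending to the infimum, a subsequence of coefficient vectors converges,
   and the corresponding [eta n] converge in probability to the limiting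
   combination, which is again in [A0 M] up to a null set. *)

(** * Null sets and compactness of bounded row vectors *)

Lemma null_dominates_ae {d : measure_display} {T : measurableType d}
    {R : realType} {P Q : probability T R} {A : T -> Prop} :
  P `<< Q -> {ae Q, forall x, A x} -> {ae P, forall x, A x}.
Proof.
move=> /null_content_dominatesP PQ [B [mB B0 sB]].
by exists B; split => //; exact: PQ.
Qed.

Lemma ler_rV_norm_coord {R : realType} {n : nat} (v : 'rV[R]_n) (i : 'I_n) :
  `|v ord0 i| <= `|v|.
Proof.
rewrite [leRHS]/Num.norm /= mx_normrE; apply/bigmax_geP; right => /=.
by exists (ord0, i).
Qed.

(** Closed balls are compact, so [u] has a cluster point [l], and every ball around [l] meets every
    tail of [u]. The indices [s m] need not increase: [m <= s m] is enough to pass to limits, and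
    the explicit rate is reused as a harmonic bound. *)
Lemma bounded_rV_subseq {R : realType} {n : nat} {u : nat -> 'rV[R]_n} {B : R} :
  (forall m, `|u m| <= B) ->
  exists (l : 'rV[R]_n) (s : nat -> nat),
    forall m, (m <= s m)%N /\ `|u (s m) - l| <= m.+1%:R^-1.
Proof.
move=> uB.
have : compact [set v : 'rV[R]_n | `|v| <= B].
  apply: bounded_closed_compact.
    by exists B; split=> [|x Bx v /= vB]; [exact: num_real|
      exact: le_trans vB (ltW Bx)].
  apply: (@preimage_closed _ _ (fun v : 'rV[R]_n => `|v|) [set x | x <= B]).
  - by move=> x _; exact: norm_continuous.
  - exact: closed_le.
move=> /(_ (u @ \oo) _) [|l [_ ul]]; first by exists 0%N => // m _; exact: uB.
exists l.
suff /choice[s] : forall m, exists k, (m <= k)%N /\ `|u k - l| <= m.+1%:R^-1.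
  by exists s.
move=> m.
have [||_ [[k /= mk <-] lk]] :=
  ul (u @` [set k | (m <= k)%N]) (ball l m.+1%:R^-1).
- by exists m => // k /= mk; exists k.
- by apply: nbhsx_ballx; rewrite invr_gt0.
- exists k; split=> //; rewrite distrC; apply: ltW.
  by move: lk; rewrite -ball_normE.
Qed.

(** * Linear combinations and their L^1 norms *)

Definition lincomb {T : Type} {R : realType} {k : nat} (xi : 'I_k -> T -> R)
    (c : 'rV[R]_k) (x : T) : R :=
  \sum_(i < k) c ord0 i * xi i x.

Lemma lincombB {T : Type} {R : realType} {k : nat} (xi : 'I_k -> T -> R)
    (c c' : 'rV[R]_k) (x : T) :
  lincomb xi (c - c') x = lincomb xi c x - lincomb xi c' x.
Proof.
by rewrite /lincomb -sumrB; apply: eq_bigr => i _; rewrite !mxE mulrBl.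
Qed.

Lemma lincombZ {T : Type} {R : realType} {k : nat} (xi : 'I_k -> T -> R)
    (a : R) (c : 'rV[R]_k) (x : T) :
  lincomb xi (a *: c) x = a * lincomb xi c x.
Proof.
by rewrite /lincomb mulr_sumr; apply: eq_bigr => i _; rewrite mxE mulrA.
Qed.

Lemma ler_norm_lincomb {T : Type} {R : realType} {k : nat}
    (xi : 'I_k -> T -> R) (c : 'rV[R]_k) (x : T) :
  `|lincomb xi c x| <= `|c| * \sum_(i < k) `|xi i x|.
Proof.
rewrite mulr_sumr (le_trans (ler_norm_sum _ _ _))// ler_sum// => i _.
by rewrite normrM ler_wpM2r// ler_rV_norm_coord.
Qed.

Section integral_lincomb.
Context {d : measure_display} {T : measurableType d} {R : realType}.
Context {P : probability T R} {k : nat} {xi : 'I_k -> T -> R}.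
Hypothesis ixi : forall i, P.-integrable [set: T] (EFin \o xi i).

Lemma integrable_lincomb (c : 'rV[R]_k) :
  P.-integrable [set: T] (EFin \o lincomb xi c).
Proof.
apply: (@eq_integrable _ _ _ _ _ _
  (fun x => \sum_(i < k) ((c ord0 i)%:E * (xi i x)%:E))%E) => //.
  by move=> x _; rewrite /= /lincomb -sumEFin.
by apply: integrable_sum => // i _; apply: integrableZl => //; exact: ixi.
Qed.

Lemma Rintegral_lincomb (c : 'rV[R]_k) :
  \int[P]_x lincomb xi c x = \sum_(i < k) c ord0 i * \int[P]_x xi i x.
Proof.
rewrite /Rintegral /lincomb.
under eq_integral do rewrite -sumEFin.
under eq_integral do under eq_bigr do rewrite EFinM.
rewrite integral_sum//; last first.
  by move=> i; apply: integrableZl => //; exact: ixi.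
have E i : (\int[P]_x ((c ord0 i)%:E * (xi i x)%:E) =
    (c ord0 i * fine (\int[P]_x (xi i x)%:E))%:E)%E.
  rewrite integralZl//; last exact: ixi.
  by rewrite EFinM fineK//; apply: integrable_fin_num => //; exact: ixi.
by under eq_bigr do rewrite E; rewrite sumEFin.
Qed.

Lemma integrable_sum_normr :
  P.-integrable [set: T] (EFin \o (fun x => \sum_(i < k) `|xi i x|)).
Proof.
apply: (@eq_integrable _ _ _ _ _ _
  (fun x => \sum_(i < k) (`|xi i x|)%:E)%E) => //.
  by move=> x _; rewrite /= -sumEFin.
by apply: integrable_sum => // i _; exact: integrable_norm (ixi i).
Qed.

(** Linear independence makes the L^1 norm [L] positive off 0. It is Lipschitz in the coefficients,
    hence attains a positive minimum on the compact unit sphere; this minimum is [e], and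
    homogeneity gives the bound for all [c]. *)
Lemma Rintegral_norm_lincomb_ge : lin_indep P xi ->
  exists2 e : R, 0 < e &
    forall c, e * `|c| <= \int[P]_x `|lincomb xi c x|.
Proof.
move=> li; pose L (c : 'rV[R]_k) := \int[P]_x `|lincomb xi c x|.
pose S := \int[P]_x \sum_(i < k) `|xi i x|.
have iL c : P.-integrable [set: T] (EFin \o (fun x => `|lincomb xi c x|)).
  exact: integrable_norm (integrable_lincomb c).
have S0 : 0 <= S by apply: Rintegral_ge0 => x _; apply: sumr_ge0.
have L_gt0 c : c != 0 -> 0 < L c.
  move=> c0; rewrite lt_neqAle Rintegral_ge0 ?andbT//.
  apply: contra c0 => /eqP L0; apply/eqP/rowP => i; rewrite mxE.
  have /ae_eq_integral_abs : (\int[P]_x `|(lincomb xi c x)%:E| = 0)%E.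
    transitivity ((L c)%:E); last by rewrite -L0.
    by rewrite /L /Rintegral fineK//; apply: integrable_fin_num (iL c).
  move=> /(_ measurableT) ae0; apply: (li (fun i => c ord0 i)).
  have := ae0 (measurable_int _ (integrable_lincomb c)).
  by apply: filterS => x /(_ I) [].
have L_le c c' : L c <= L c' + `|c - c'| * S.
  rewrite -RintegralZl//; last exact: integrable_sum_normr.
  have iS : P.-integrable [set: T]
      (EFin \o (fun x => `|c - c'| * \sum_(i < k) `|xi i x|)).
    exact: integrableZl integrable_sum_normr.
  rewrite -RintegralD//; apply: le_Rintegral => //.
    exact: (integrableD _ (iL c') iS).
  move=> x _; have := ler_norm_lincomb xi (c - c') x.
  by rewrite lincombB => /(le_trans (lerB_dist _ _)); rewrite lerBlDl.
have cL : continuous L.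
  move=> c; apply/(@cvgrPdist_le _ _ _ (nbhs c) (nbhs_filter c)) => e e0; near=> c'.
  have cc' : `|c - c'| * S <= e.
    (* [S] may vanish, so the radius around [c] is [e / (S + 1)]. *)
    rewrite (@le_trans _ _ (`|c - c'| * (S + 1)))//.
      by rewrite ler_wpM2l// lerDl.
    rewrite -ler_pdivlMr ?ltr_wpDl//; near: c'.
    have /(@cvgr_dist_le _ _ _ _ _ id c) : id @ nbhs c --> c by exact: cvg_id.
    by apply; rewrite divr_gt0// ltr_wpDl.
  rewrite ler_distl; apply/andP; split.
    by rewrite lerBlDr (le_trans (L_le c' c))// lerD2l distrC.
  by rewrite (le_trans (L_le c c'))// lerD2l.
pose sphere : set 'rV[R]_k := [set c | `|c| = 1].
have cS : compact sphere.
  apply: bounded_closed_compact.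
    by exists 1; split=> [|x x1 v /= ->]; [exact: num_real|exact: ltW].
  apply: (@preimage_closed _ _ (fun v : 'rV[R]_k => `|v|) [set x | x = 1]).
  - by move=> x _; exact: norm_continuous.
  - exact: closed_eq.
have nS c : c != 0 -> sphere (`|c|^-1 *: c).
  by move=> c0; rewrite /sphere /= normrZ normfV normr_id mulVf// normr_eq0.
(* The sphere is empty only if 0 is the sole vector; then any positive constant will do. *)
have [[c0 c01]|noS] := pselect (sphere !=set0); last first.
  exists 1 => // c; have [->|/nS cS'] := eqVneq c 0.
    by rewrite normr0 mulr0 Rintegral_ge0.
  by exfalso; apply: noS; eexists; exact: cS'.
have [m mS mL] := EVT_min_rV (ex_intro _ _ c01) cS (continuous_subspaceT cL).
exists (L m).
  apply: L_gt0; rewrite -normr_eq0; move: mS; rewrite inE /sphere /= => ->.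
  exact: oner_neq0.
move=> c; have [->|cN0] := eqVneq c 0.
  by rewrite normr0 mulr0 Rintegral_ge0.
have c_gt0 : 0 < `|c| by rewrite normr_gt0.
have := mL _ (mem_set (nS _ cN0)).
rewrite {2}/L.
under eq_Rintegral do rewrite lincombZ normrM normfV normr_id.
by rewrite RintegralZl// mulrC ler_pdivlMr.
Unshelve. all: by end_near. Qed.

End integral_lincomb.

(** Putting [eta] in front of [xi] gives [k.+1] elements of [A], which are dependent by maximality.
    The coefficient of [eta] is nonzero, since otherwise [xi] itself would be dependent, so one can
    divide by it. *)
Lemma max_lin_indep_span {d : measure_display} {T : measurableType d}
    {R : realType} {P : probability T R} {A : set (T -> R)} {k : nat}
    {xi : 'I_k -> T -> R} {eta : T -> R} :
  max_lin_indep P A xi -> A eta ->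
  exists c : 'rV[R]_k, {ae P, forall x, eta x = lincomb xi c x}.
Proof.
move=> [Axi li maxk] Aeta.
pose zs (i : 'I_k.+1) := oapp xi eta (unlift ord0 i).
have zs0 : zs ord0 = eta by rewrite /zs unlift_none.
have zsS i : zs (lift ord0 i) = xi i by rewrite /zs liftK.
have Azs i : A (zs i).
  by case: (unliftP ord0 i) => [j|] ->; rewrite ?zsS ?zs0.
have /existsNP[c /not_implyP[c0 /existsNP[i ci]]] : ~ lin_indep P zs.
  by move=> /(maxk _ _ Azs); rewrite ltnn.
have {}c0 : {ae P, forall x,
    c ord0 * eta x + \sum_(j < k) c (lift ord0 j) * xi j x = 0}.
  apply: filterS c0 => x; rewrite big_ord_recl zs0.
  by under eq_bigr do rewrite zsS.
have c00 : c ord0 != 0.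
  apply/eqP => c00; apply: ci.
  case: (unliftP ord0 i) => [j|] -> //.
  apply: (li (fun j => c (lift ord0 j))).
  by apply: filterS c0 => x; rewrite c00 mul0r add0r.
exists (\row_j (- (c ord0)^-1 * c (lift ord0 j))).
apply: filterS c0 => x /eqP; rewrite addr_eq0 => /eqP cx.
rewrite -[LHS](mulKf c00) cx mulrN -mulNr /lincomb mulr_sumr.
by apply: eq_bigr => j _; rewrite mxE mulrA.
Qed.

(** * Expectations, almost sure equality and convergence in probability *)

Lemma Rintegral_A0 {d : measure_display} {T : measurableType d} {R : realType}
    {M : set (probability T R)} {P : probability T R} {eta : T -> R} :
  M P -> A0 M eta -> \int[P]_x eta x = 1.
Proof. by move=> MP [_ _ /(_ P MP)]; rewrite unlock /Rintegral => ->. Qed.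

Lemma ae_eq_Rintegral {d : measure_display} {T : measurableType d}
    {R : realType} {P : probability T R} {g h : T -> R} :
  measurable_fun [set: T] g -> measurable_fun [set: T] h ->
  {ae P, forall x, g x = h x} -> \int[P]_x g x = \int[P]_x h x.
Proof.
move=> mg mh gh; congr fine; apply: ae_eq_integral => //.
- exact/measurable_EFinP.
- exact/measurable_EFinP.
- by apply: filterS gh => x -> _.
Qed.

Lemma ae_eq_integrable {d : measure_display} {T : measurableType d}
    {R : realType} {P : probability T R} {g h : T -> R} :
  measurable_fun [set: T] g -> {ae P, forall x, g x = h x} ->
  P.-integrable [set: T] (EFin \o h) -> P.-integrable [set: T] (EFin \o g).
Proof.
move=> mg gh /integrableP[mh hoo]; have mg' : measurable_fun [set: T] (EFin \o g).
  exact/measurable_EFinP.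
apply/integrableP; split=> //.
rewrite (ae_eq_integral (fun x => `|(EFin \o h) x|%E))//.
- exact: measurableT_comp.
- exact: measurableT_comp.
- by apply: filterS gh => x /= -> _.
Qed.

(** The probability of a deviation beyond [e] is at most [|r n| * E|S| / e], which tends to 0. The
    absolute values avoid sign assumptions on [r] and [S]. *)
Lemma cvg_in_probability_le {d : measure_display} {T : measurableType d}
    {R : realType} {P : probability T R} {eta : nat -> T -> R}
    {zeta S : T -> R} {r : nat -> R} :
  (forall n, measurable_fun [set: T] (eta n)) ->
  measurable_fun [set: T] zeta ->
  P.-integrable [set: T] (EFin \o S) ->
  (forall n, {ae P, forall x, `|eta n x - zeta x| <= r n * S x}) ->
  r n @[n --> \oo] --> 0 ->
  cvg_in_probability P eta zeta.
Proof.
move=> meta mzeta iS le_rS r0 e e0.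
have mD n : measurable_fun [set: T] (fun x => eta n x - zeta x).
  exact: measurable_funB.
have mabs n :
    measurable_fun [set: T] (fun x => `|(eta n x - zeta x)%R%:E|%E).
  by apply: measurableT_comp => //; exact/measurable_EFinP.
have mA n : measurable [set x | e < `|eta n x - zeta x|].
  rewrite -[X in measurable X]setTI.
  exact: (emeasurable_fun_o_infty measurableT (mabs n) e%:E).
pose I := (\int[P]_x `|(S x)%:E|)%E.
have Ifin : I \is a fin_num.
  by apply: integrable_fin_num => //; exact: integrable_abse iS.
have bound n : (P [set x | (e < `|eta n x - zeta x|)%R] <=
    (`|r n| * fine I * e^-1)%R%:E)%E.
  rewrite EFinM -[X in (X <= _)%E]mule1 -(mulfV (lt0r_neq0 e0)) EFinM muleA.
  rewrite lee_wpmul2r ?lee_fin ?invr_ge0 ?(ltW e0)// muleC.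
  (* Markov's inequality *)
  have Le : (e%:E * P [set x | (e%:E <= `|(eta n x - zeta x)%R%:E|)%E] <=
      \int[P]_x `|(eta n x - zeta x)%R%:E|)%E.
    have := @le_integral_comp_abse _ _ _ P setT measurableT
      (EFin \o (fun x => eta n x - zeta x)) e id (@measurable_id _ _ _) _ _ _ e0.
    rewrite setTI; apply => //.
    exact/measurable_EFinP.
  apply: (@le_trans _ _ (e%:E * P [set x | (e%:E <= `|(eta n x - zeta x)%R%:E|)%E])%E).
    rewrite lee_wpmul2l ?lee_fin ?(ltW e0)// le_measure ?inE//; last first.
      by move=> x /= /ltW; rewrite lee_fin.
    rewrite -[X in measurable X]setTI.
    exact: emeasurable_fun_c_infty.
  apply: (le_trans Le).
  rewrite EFinM fineK// /I -ge0_integralZl//; last first.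
    by apply: measurableT_comp => //; exact: measurable_int iS.
  apply: ae_ge0_le_integral => //.
  - apply: measurable_funeM; apply: measurableT_comp => //.
    exact: measurable_int iS.
  - apply: filterS (le_rS n) => x leS _; rewrite -EFinM lee_fin.
    by rewrite (le_trans leS)// -normrM ler_norm.
apply: (@squeeze_cvge _ _ _ _ (cst 0%E) _
  (fun n => (`|r n| * fine I * e^-1)%:E)).
- by near=> n; rewrite measure_ge0/=.
- exact: cvg_cst.
- apply: cvg_EFin.
    by near=> n.
  rewrite -[X in _ --> X](mul0r e^-1); apply: cvgMl.
  rewrite -[X in _ --> X](mul0r (fine I)); apply: cvgMl.
  by rewrite -(normr0 R); apply: cvg_norm.
Unshelve. all: by end_near. Qed.

(** * Existence of the fair price *)

Theorem theorem16 (d : measure_display) (T : measurableType d) (R : realType)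
  (F : nat -> set (set T)) (M : set (probability T R)) (P0 : probability T R)
  (k N : nat) (xi : 'I_k -> T -> R) (f : T -> R) (xi0 : T -> R) (a0 : R)
  (hF : filtration F)
  (hM : admissible_family F M P0)
  (hk : (1 <= k)%N)
  (hxi : max_lin_indep P0 (A0 M) xi)
  (hf0 : forall x, 0 <= f x)
  (hfN : sub_measurable_fun (F N) f)
  (hfM : M_integrable M f)
  (hxi0 : convex_combinations xi xi0)
  (ha0 : 0 <= a0)
  (hsup : superhedged F M N f a0 xi0) :
  fair_price_exists F M N f a0.
Proof.
have MP0 := family_base hM.
have [Axi li _] := hxi.
have ixi P : M P -> forall i, P.-integrable [set: T] (EFin \o xi i).
  by move=> MP i; have [_ /(_ _ MP)] := Axi i.
have mA0 eta : A0 M eta -> measurable_fun [set: T] eta.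
  by move=> [_ /(_ _ MP0) /measurable_int ieta _]; exact/measurable_EFinP.
have mlin c : measurable_fun [set: T] (lincomb xi c).
  by apply/measurable_EFinP/measurable_int/(integrable_lincomb (ixi _ MP0) c).
have Elin P c : M P -> \int[P]_x lincomb xi c x = \sum_(i < k) c ord0 i.
  move=> MP; rewrite (Rintegral_lincomb (ixi _ MP)).
  by apply: eq_bigr => i _; rewrite (Rintegral_A0 MP (Axi i)) mulr1.
(* Measurability of [zeta] is asked for separately: almost sure equality does not transfer it when
   the measure is not complete. *)
have A0P (zeta : T -> R) c : (forall x, 0 <= zeta x) -> measurable_fun [set: T] zeta ->
    (forall P, M P -> {ae P, forall x, zeta x = lincomb xi c x}) ->
    \sum_(i < k) c ord0 i = 1 -> A0 M zeta.
  move=> zeta0 mzeta zetac c1.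
  have iz P : M P -> P.-integrable [set: T] (EFin \o zeta).
    move=> MP; apply: ae_eq_integrable (zetac _ MP) _ => //.
    exact: integrable_lincomb (ixi _ MP) c.
  split=> // P MP; rewrite unlock -[LHS]fineK; last first.
    exact: integrable_fin_num (iz _ MP).
  by rewrite [fine _](ae_eq_Rintegral _ _ (zetac _ MP))// Elin// c1.
have pa0 : price_set F M N f a0 a0.
  split; first by rewrite ha0 lexx.
  exists xi0 => //; case: hxi0 => xi00 [a [a_ge0 a1 xi0E]].
  have xi0lin x : xi0 x = lincomb xi (\row_i a i) x.
    by rewrite xi0E; apply: eq_bigr => i _; rewrite mxE.
  apply: (A0P _ (\row_i a i)) => //.
  - by rewrite (funext xi0lin).
  - by move=> P MP; exact: aeW.
  - by rewrite -[RHS]a1; apply: eq_bigr => i _; rewrite mxE.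
have hinf : has_inf (price_set F M N f a0).
  by split; [exists a0|exists 0 => a [/andP[]]].
pose f0 := fair_price F M N f a0.
(* A price within [1/(n+1)] of the infimum, its superhedging element and the coefficients of that
   element. The coefficients are found [P0]-a.s.; equivalence of the measures makes them valid under
   every [P] in [M]. *)
have /choice[w wP] n : exists w : R * (T -> R) * 'rV[R]_k,
    [/\ 0 <= w.1.1 <= a0, f0 <= w.1.1 < f0 + n.+1%:R^-1, A0 M w.1.2,
        superhedged F M N f w.1.1 w.1.2 &
        forall P, M P -> {ae P, forall x, w.1.2 x = lincomb xi w.2 x}].
  have n0 : 0 < n.+1%:R^-1 :> R by rewrite invr_gt0.
  have [a pa af] := inf_adherent n0 hinf.
  have [a0a [eta Aeta sup]] := pa.
  have [c etac] := max_lin_indep_span hxi Aeta.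
  exists (a, eta, c); split=> //=.
    by rewrite af andbT; apply: ge_inf => //; exact: hinf.2.
  by move=> P MP; apply: null_dominates_ae etac; exact: (family_equiv hM).
pose a n := (w n).1.1; pose eta n := (w n).1.2; pose c n := (w n).2.
have Aeta n : A0 M (eta n) by have [] := wP n.
have etac n P : M P -> {ae P, forall x, eta n x = lincomb xi (c n) x}.
  by have [_ _ _ _] := wP n; exact.
(* [eta n] and every [xi i] have mean 1. *)
have c1 n : \sum_(i < k) c n ord0 i = 1.
  rewrite -(Elin _ _ MP0) -(Rintegral_A0 MP0 (Aeta n)).
  by apply/esym/ae_eq_Rintegral => //; [exact: mA0|exact: etac].
have [e e0 ec] := Rintegral_norm_lincomb_ge (ixi _ MP0) li.
(* [eta n] is nonnegative with mean 1, so its L^1 norm is 1 and [e * |c n| <= 1]. *)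
have cB n : `|c n| <= e^-1.
  rewrite -[leRHS]mulr1 ler_pdivlMl// (le_trans (ec _))//.
  rewrite -(Rintegral_A0 MP0 (Aeta n)) le_eqVlt; apply/orP; left; apply/eqP.
  apply: ae_eq_Rintegral; [|exact: mA0|].
    exact: measurableT_comp.
  apply: filterS (etac n _ MP0) => x <-; apply: ger0_norm.
  by case: (Aeta n).
have [l [s sP]] := bounded_rV_subseq cB.
pose S x := \sum_(i < k) `|xi i x|.
have S0 x : 0 <= S x by apply: sumr_ge0.
have cl n x : `|lincomb xi (c (s n)) x - lincomb xi l x| <= n.+1%:R^-1 * S x.
  rewrite -lincombB; apply: le_trans (ler_norm_lincomb _ _ _) _.
  by apply: ler_wpM2r; [exact: S0|have [] := sP n].
have small (y z : R) : (forall n, y <= n.+1%:R^-1 * z) -> y <= 0.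
  have : n.+1%:R^-1 * z @[n --> \oo] --> 0.
    by rewrite -[X in _ --> X](mul0r z); apply: cvgMl; exact: cvg_harmonic.
  by move=> hz yz; apply: (cvgr_to_ge hz); near=> n; exact: yz.
have l1 : \sum_(i < k) l ord0 i = 1.
  apply/eqP; rewrite eq_sym -subr_eq0 -normr_le0.
  (* Each of the [k] coordinates of [c (s n) - l] is at most [1/(n+1)] in absolute value, so the
     sums differ by at most [k/(n+1)]. *)
  apply: (small _ (\sum_(i < k) 1)) => n.
  rewrite -[X in `|X - _|](c1 (s n)) -sumrB (le_trans (ler_norm_sum _ _ _))//.
  rewrite mulr_sumr ler_sum// => i _.
  rewrite mulr1; have [_] := sP n; apply: le_trans.
  by have := ler_rV_norm_coord (c (s n) - l) i; rewrite !mxE.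
(* [lincomb xi l] is nonnegative only almost surely, whereas membership in
   [A0 M] asks for it everywhere. *)
pose zeta x := Num.max 0 (lincomb xi l x).
have mzeta : measurable_fun [set: T] zeta by exact: measurable_maxr.
have zetal P : M P -> {ae P, forall x, zeta x = lincomb xi l x}.
  (* Off one null set, all [eta (s n)] equal their combinations. These are nonnegative and within
     [S x / (n+1)] of [lincomb xi l x], which is therefore nonnegative. *)
  move=> MP; have := ae_foralln (fun n => etac (s n) _ MP).
  apply: filterS => x etax; apply/max_idPr; rewrite -oppr_le0.
  apply: (small _ (S x)) => n.
  rewrite (le_trans _ (cl n x))// (le_trans _ (ler_norm _))// lerDr -etax.
  by case: (Aeta (s n)).
have Azeta : A0 M zeta.
  by apply: (A0P _ l) => // x; rewrite le_max lexx.
exists zeta, (a \o s), (eta \o s); split => //.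
- by move=> n; split => //=; have [] := wP (s n).
- apply/cvgrPdist_le => r r0; near=> n.
  have [_ /andP[f0a af0] _ _ _] := wP (s n).
  rewrite distrC ger0_norm ?subr_ge0// lerBlDl (le_trans (ltW af0))// lerD2l.
  have [sn _] := sP n.
  (* The gap at index [s n] is below [1/(s n + 1)], and [n <= s n]. *)
  rewrite (@le_trans _ _ n.+1%:R^-1)//.
    by rewrite lef_pV2 ?posrE// ler_nat ltnS.
  apply: ltW; near: n; exact: (near_infty_natSinv_lt (PosNum r0)).
- move=> P MP.
  apply: (@cvg_in_probability_le _ _ _ _ _ _ S (@harmonic R)) => //.
  + by move=> n; exact/mA0/Aeta.
  + exact: integrable_sum_normr (ixi _ MP).
  + by move=> n; apply: filterS2 (etac (s n) _ MP) (zetal _ MP) => x /= -> ->.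
  + exact: cvg_harmonic.
- by move=> n; have [] := wP (s n).
Unshelve. all: by end_near. Qed.
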